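(* Let $n\ge 2$. For each $k\ge n+3$ there is a full $k$-coloring $\Gamma$ of $\mathbb{S}^n$ such that every $(n-1)$-sphere $S\subset\mathbb{S}^n$ is colored with $n+2$ or fewer colors, i.e. $|\Gamma(S)|\le n+2$.
   Context: The standard $n$-sphere is $\mathbb{S}^n = \{(x_0,\dots,x_n)\in\mathbb{R}^{n+1} : \sum_{i=0}^n x_i^2 = 1\}$. A full $k$-coloring of $\mathbb{S}^n$ is a surjective map $\Gamma:\mathbb{S}^n\to\{1,\dots,k\}$; no regularity is assumed. An $(n-1)$-sphere in $\mathbb{S}^n$ is a set of the form $P\cap\mathbb{S}^n$, where $P$ is an affine hyperplane of $\mathbb{R}^{n+1}$ (not necessarily through the origin) that meets the open ball bounded by $\mathbb{S}^n$. *)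

(* Defs.v *)
From HB Require Import structures.
From mathcomp Require Import all_boot all_order all_algebra.
From mathcomp Require Import boolp classical_sets functions cardinality reals.

Set Implicit Arguments.
Unset Strict Implicit.
Unset Printing Implicit Defensive.

Import Order.TTheory GRing.Theory Num.Theory.

Local Open Scope classical_set_scope.
Local Open Scope ring_scope.

(* Euclidean norm and inner product are written out as sums because the
   library norm `|x| on row vectors is the sup norm. *)
Definition sphere (R : realType) (n : nat) : set 'rV[R]_n.+1 :=
  [set x | \sum_(i < n.+1) x 0 i ^+ 2 = 1].
Arguments sphere : clear implicits.

Definition open_ball (R : realType) (n : nat) : set 'rV[R]_n.+1 :=
  [set x | \sum_(i < n.+1) x 0 i ^+ 2 < 1].
Arguments open_ball : clear implicits.

Definition affine_hyperplane (R : realType) (m : nat) (P : set 'rV[R]_m) :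
    Prop :=
  exists (a : 'rV[R]_m) (b : R),
    a != 0 /\ P = [set x | \sum_(i < m) a 0 i * x 0 i = b].

(* [sphere R n] is used as a type through the coercion from sets to types. *)
Definition hypersphere (R : realType) (n : nat) (S : set (sphere R n)) : Prop :=
  exists P : set 'rV[R]_n.+1,
    [/\ affine_hyperplane P,
        P `&` open_ball R n !=set0
      & S = [set x : sphere R n | P (val x)]].

(* The colors 1, ..., k are represented by 'I_k. *)
Definition full_coloring (R : realType) (n k : nat)
    (Gamma : sphere R n -> 'I_k) : Prop :=
  set_surj [set: sphere R n] [set: 'I_k] Gamma.

(* Main.v *)
Require Import Defs.
From mathcomp Require Import all_boot all_order all_algebra.
From mathcomp Require Import ring polyrcf.
From mathcomp Require Import boolp classical_sets functions cardinality reals.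

(** Color k - 1 suitably chosen points of the sphere with pairwise distinct
    colors, and everything else with the one remaining color.  A hypersphere
    then carries at most n + 2 colors as soon as no hyperplane contains more
    than n + 1 of the chosen points, that is, as soon as these points are in
    general position.

    Such points are found on the curve obtained by lifting the moment curve
    t |-> (t, t^2, ..., t^n) of R^n to the sphere by inverse stereographic
    projection.  Hyperplane sections of the sphere correspond to the spheres
    and hyperplanes of R^n, so a hyperplane meets the lifted curve at the roots
    of a polynomial A (t^2 + t^4 + ... + t^2n) + q(t) with q of degree at most
    n ([hyperplane_curve_pt]).  If A is nonzero, then the (n+1)-st derivative of
    this polynomial has the constant sign of A on t > 0; if A = 0, then it is a
    nonzero polynomial of degree at most n.  Rolle's theorem in the first case
    ([size_pos_roots_derivn]), and the degree in the second, leave at most n + 1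
    positive roots ([size_hyperplane_curve]). *)

Set Implicit Arguments.
Unset Strict Implicit.
Unset Printing Implicit Defensive.

Import Order.TTheory GRing.Theory Num.Theory.

Local Open Scope ring_scope.

(** * Counting positive roots with Rolle's theorem *)

(** Rolle's theorem between each pair of consecutive roots.  Sequences are
    sorted so that the new roots, being separated by the old ones, are again
    distinct. *)
Lemma rolle_sorted (R : rcfType) (p : {poly R}) (x : R) (rs : seq R) :
  path <%R x rs -> all (root p) (x :: rs) ->
  exists rs', [/\ size rs' = size rs, path <%R x rs' & all (root p^`()) rs'].
Proof.
elim: rs x => [|y rs IHrs] x /=; first by exists [::].
move=> /andP[ltxy ys] /and3P[px py prs].
have [|rs' [sz_rs' path_rs' root_rs']] := IHrs y ys; first by rewrite /= py.
have [|c] := poly_rolle (p := p) ltxy; first by rewrite (eqP px) (eqP py).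
rewrite in_itv /= => /andP[ltxc ltcy] pc0.
exists (c :: rs'); rewrite /= sz_rs' ltxc root_rs' /root pc0 eqxx; split=> //.
case: rs' path_rs' {sz_rs' root_rs'} => //= z rs' /andP[ltyz ->].
by rewrite (lt_trans ltcy ltyz).
Qed.

Lemma size_sorted_pos_roots_derivn (R : rcfType) (m : nat) (p : {poly R})
    (rs : seq R) :
  (forall x, 0 < x -> p^`(m).[x] != 0) ->
  sorted <%R rs -> all (> 0) rs -> all (root p) rs -> (size rs <= m)%N.
Proof.
elim: m p rs => [|m IHm] p [|x rs] // dp_neq0.
  by move=> _ /= /andP[/dp_neq0 /negPf px _] /andP[]; rewrite /root px.
move=> path_rs /= /andP[x_gt0 _] root_rs.
have [rs' [<- path_rs' root_rs']] := rolle_sorted path_rs root_rs.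
apply: (IHm p^`()) => //; first by move=> y; rewrite -derivSn; apply: dp_neq0.
  exact: path_sorted path_rs'.
apply: sub_all (order_path_min lt_trans path_rs') => y.
exact: lt_trans.
Qed.

Lemma size_pos_roots_derivn (R : rcfType) (m : nat) (p : {poly R})
    (rs : seq R) :
  (forall x, 0 < x -> p^`(m).[x] != 0) ->
  uniq rs -> all (> 0) rs -> all (root p) rs -> (size rs <= m)%N.
Proof.
move=> dp_neq0 uniq_rs rs_gt0 root_rs; rewrite -(size_sort <=%R).
by apply: size_sorted_pos_roots_derivn dp_neq0 _ _ _;
  rewrite ?sort_lt_sorted ?all_sort.
Qed.

(** * The moment curve lifted to the sphere *)

Section Curve.
Variables (R : realType) (n : nat).
Implicit Types (t b : R) (a : 'rV[R]_n.+1).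

Definition moment_sqnorm : {poly R} := \sum_(i < n) 'X^(i.+1 * 2).

Lemma moment_sqnormE t : moment_sqnorm.[t] = \sum_(i < n) (t ^+ i.+1) ^+ 2.
Proof.
by rewrite horner_sum; apply: eq_bigr => i _; rewrite hornerXn exprM.
Qed.

Lemma moment_sqnorm1_gt0 t : 0 < moment_sqnorm.[t] + 1.
Proof.
rewrite ltr_wpDl // moment_sqnormE.
by apply: sumr_ge0 => i _; apply: sqr_ge0.
Qed.

(** The leading term survives because 2n >= n + 1; the other terms can only
    contribute nonnegative amounts. *)
Lemma derivn_moment_sqnorm_gt0 t :
  (0 < n)%N -> 0 < t -> 0 < moment_sqnorm^`(n.+1).[t].
Proof.
move=> n_gt0 t_gt0.
have last_lt : (n.-1 < n)%N by rewrite prednK.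
rewrite /moment_sqnorm (bigD1 (Ordinal last_lt)) // derivnD hornerD.
apply: ltr_wpDr; last first.
  rewrite [nat_of_ord _]/= derivnXn hornerMn hornerXn pmulrn_lgt0 ?exprn_gt0 //.
  by rewrite ffact_gt0 prednK // muln2 -addnn -addn1 leq_add2l.
rewrite (big_morph (derivn n.+1) (@derivnD _ n.+1) (derivnC _ _)) horner_sum.
apply: sumr_ge0 => i _.
by rewrite derivnXn hornerMn hornerXn mulrn_wge0 // exprn_ge0 // ltW.
Qed.

Definition curve_pt t : 'rV[R]_n.+1 :=
  \row_(i < n.+1) ((if i == 0 then moment_sqnorm.[t] - 1 else 2 * t ^+ i)
                   / (moment_sqnorm.[t] + 1)).

Lemma curve_pt_sphere t : sphere R n (curve_pt t).
Proof.
have s1_neq0 := lt0r_neq0 (moment_sqnorm1_gt0 t).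
rewrite /sphere /= big_ord_recl !mxE eqxx.
under eq_bigr => i _ do rewrite mxE -[lift _ _ == _]/false /= exprMn exprMn.
rewrite -mulr_suml -mulr_sumr -moment_sqnormE.
by field.
Qed.

(** Coordinate 0 is an injective function of the squared norm on the moment
    curve; once that is known, coordinate 1 gives back the parameter. *)
Lemma curve_pt_inj : (0 < n)%N -> injective curve_pt.
Proof.
move=> n_gt0 t u /rowP eq_tu.
have s_neq0 v := lt0r_neq0 (moment_sqnorm1_gt0 v).
have eq_s : moment_sqnorm.[t] = moment_sqnorm.[u].
  have := eq_tu 0; rewrite !mxE eqxx => /eqP.
  rewrite eqr_div // => /eqP eq0.
  set T := moment_sqnorm.[t] in eq0 *; set U := moment_sqnorm.[u] in eq0 *.
  have : 2 * (T - U) = (T - 1) * (U + 1) - (U - 1) * (T + 1) by ring.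
  rewrite eq0 subrr.
  by move/eqP; rewrite mulf_eq0 pnatr_eq0 subr_eq0 => /eqP.
have := eq_tu (lift ord0 (Ordinal n_gt0)).
rewrite !mxE -[lift _ _ == _]/false eq_s /= expr1.
by move/(mulIf (invr_neq0 (s_neq0 u)))/mulfI; apply; rewrite pnatr_eq0.
Qed.

Definition hyperplane_poly a b : {poly R} :=
  (a 0 0 - b) *: moment_sqnorm
  + (\sum_(i < n) (2 * a 0 (lift ord0 i)) *: 'X^(i.+1) - (a 0 0 + b)%:P).

(** Multiplying the equation of the hyperplane by the denominator of [curve_pt]
    turns it into a polynomial equation in the parameter. *)
Lemma hyperplane_curve_pt a b t :
  (\sum_(i < n.+1) a 0 i * curve_pt t 0 i == b) = root (hyperplane_poly a b) t.
Proof.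
have s1_neq0 := lt0r_neq0 (moment_sqnorm1_gt0 t).
rewrite /root /hyperplane_poly !hornerD hornerZ hornerN hornerC -subr_eq0.
rewrite -[LHS](mulrI_eq0 _ (lregP s1_neq0)); congr (_ == 0).
rewrite big_ord_recl !mxE eqxx.
under eq_bigr => i _ do rewrite mxE -[lift _ _ == _]/false /= mulrA.
set s := moment_sqnorm.[t] in s1_neq0 *; rewrite horner_sum.
under [in RHS]eq_bigr => i _ do rewrite hornerZ hornerXn -mulrA mulrCA.
rewrite -mulr_suml.
set S := (X in _ = _ + (X - _)); rewrite -[X in _ + X / _]/S.
by field.
Qed.

(** When b = a_0 the squared-norm term disappears, and the remaining
    coefficients are, up to nonzero factors, the coordinates of a. *)
Lemma hyperplane_poly_eq0 a :
  hyperplane_poly a (a 0 0) = 0 -> a = 0.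
Proof.
rewrite /hyperplane_poly subrr scale0r add0r => p0.
apply/rowP => i; rewrite mxE.
have two_inj (x : R) : 2 * x = 0 -> x = 0.
  by move/eqP; rewrite mulf_eq0 pnatr_eq0 => /eqP.
have [->|[j ->]] : i = ord0 \/ exists j, i = lift ord0 j.
  by case: (unliftP ord0 i) => [j|] ->; [right; exists j | left].
- have := congr1 (fun p : {poly R} => p`_0) p0.
  rewrite coefB coefC coef0 coef_sum big1 => [|j _]; last first.
    by rewrite coefZ coefXn mulr0.
  by move=> /eqP; rewrite sub0r oppr_eq0 => /eqP aa; apply: two_inj; ring: aa.
- have := congr1 (fun p : {poly R} => p`_j.+1) p0.
  rewrite coefB coefC subr0 coef0 coef_sum (bigD1 j) //= big1 => [|l lj].
    by rewrite addr0 coefZ coefXn eqxx mulr1 => /two_inj.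
  by rewrite coefZ coefXn eqSS eq_sym (inj_eq val_inj) (negPf lj) mulr0.
Qed.

(** The lifted moment curve is in general position on t > 0. *)
Lemma size_hyperplane_curve a b (rs : seq R) :
  (0 < n)%N -> a != 0 -> uniq rs -> all (> 0) rs ->
  all (fun t => \sum_(i < n.+1) a 0 i * curve_pt t 0 i == b) rs ->
  (size rs <= n.+1)%N.
Proof.
move=> n_gt0 a_neq0 uniq_rs rs_gt0.
rewrite (eq_all (hyperplane_curve_pt a b)) => root_rs.
have size_low : (size (\sum_(i < n) (2 * a 0 (lift ord0 i)) *: 'X^(i.+1)
    - (a 0 0 + b)%:P)%R <= n.+1)%N.
  rewrite (leq_trans (size_polyD _ _)) // geq_max size_polyN.
  rewrite (leq_trans (size_polyC_leq1 _)) // andbT.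
  apply: (leq_trans (size_sum _ _ _)); apply/bigmax_leqP => i _.
  by rewrite (leq_trans (size_scale_leq _ _)) // size_polyXn !ltnS.
have [A0|A_neq0] := eqVneq (a 0 0 - b) 0.
  have ab : a 0 0 = b by apply/eqP; rewrite -subr_eq0 A0.
  have p_neq0 : hyperplane_poly a b != 0.
    by rewrite -ab; apply: contra_neq a_neq0; apply: hyperplane_poly_eq0.
  apply: leq_trans (ltnW (max_poly_roots p_neq0 root_rs uniq_rs)) _.
  by rewrite /hyperplane_poly A0 scale0r add0r.
apply: size_pos_roots_derivn uniq_rs rs_gt0 root_rs => t t_gt0.
rewrite /hyperplane_poly derivnD (derivn_poly0 size_low) addr0 derivnZ hornerZ.
by rewrite mulf_neq0 // lt0r_neq0 // derivn_moment_sqnorm_gt0.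
Qed.

End Curve.

(** * The coloring *)

Local Open Scope classical_set_scope.
Local Open Scope card_scope.

Lemma card_seq_le (T : eqType) (s : seq T) : [set` s] #<= `I_(size s).
Proof.
case: s => [|x s]; first by rewrite set_nil; exact: card_ge0.
apply: card_le_trans (card_image_le (nth x (x :: s)) _).
apply: subset_card_le => y ys.
by exists (index y (x :: s)); [rewrite /mkset index_mem | apply: nth_index].
Qed.

Section Coloring.
Variables (R : realType) (n m : nat).

(** The integer parameters 1, ..., m + 1 serve as chosen points; the last of
    them, having the background color [ord_max], shows that this color is
    attained. *)
Definition color_pt (j : 'I_m.+1) : 'rV[R]_n.+1 := curve_pt n j.+1%:R.

Definition coloring (x : sphere R n) : 'I_m.+1 :=
  odflt ord_max [pick j | val x == color_pt j].

Lemma coloringP (x : sphere R n) :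
  coloring x = ord_max \/ val x = color_pt (coloring x).
Proof.
by rewrite /coloring; case: pickP => [j /eqP|_] /=; [right | left].
Qed.

Lemma color_pt_inj : (0 < n)%N -> injective color_pt.
Proof.
move=> n_gt0 i j /(curve_pt_inj n_gt0)/eqP; rewrite eqr_nat eqSS => /eqP.
exact: val_inj.
Qed.

Lemma coloring_surj : (0 < n)%N -> full_coloring coloring.
Proof.
move=> n_gt0 j _.
exists (exist _ (color_pt j) (mem_set (curve_pt_sphere n j.+1%:R))) => //.
rewrite /coloring; case: pickP => [i /eqP /= /(color_pt_inj n_gt0) //|].
by move/(_ j); rewrite /= eqxx.
Qed.

Lemma coloring_hypersphere (S : set (sphere R n)) :
  (0 < n)%N -> hypersphere S -> coloring @` S #<= `I_n.+2.
Proof.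
move=> n_gt0 [P [[a [b [a_neq0 ->]]] _ ->]].
pose s := [seq j <- enum 'I_m.+1 |
           \sum_(i < n.+1) a 0 i * color_pt j 0 i == b].
have size_s : (size s <= n.+1)%N.
  rewrite -(size_map (fun j : 'I_m.+1 => j.+1%:R : R)).
  apply: (size_hyperplane_curve (b := b) n_gt0 a_neq0).
  - rewrite map_inj_uniq 1?filter_uniq ?enum_uniq // => i j /eqP.
    by rewrite eqr_nat eqSS => /eqP/val_inj.
  - by apply/allP => _ /mapP[j _ ->]; rewrite ltr0Sn.
  - by apply/allP => _ /mapP[j + ->]; rewrite mem_filter => /andP[].
apply: (@card_le_trans _ _ _ [set` ord_max :: s]); last first.
  apply: card_le_trans (card_seq_le _) _.
  by rewrite card_le_II.
apply: subset_card_le => _ [x /= xP <-]; rewrite inE.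
have [->|x_eq] := coloringP x; first by rewrite eqxx.
by rewrite mem_filter -x_eq xP eqxx mem_enum orbT.
Qed.

End Coloring.

Theorem proposition4p2 (R : realType) (n k : nat)
    (hn : (2 <= n)%N) (hk : (n + 3 <= k)%N) :
  exists Gamma : sphere R n -> 'I_k,
    full_coloring Gamma /\
    forall S : set (sphere R n), hypersphere S ->
      Gamma @` S #<= `I_(n + 2).
Proof.
have n_gt0 : (0 < n)%N by exact: ltnW.
case: k hk => [|m _]; first by rewrite addn3.
exists (@coloring R n m); split; first exact: coloring_surj.
by move=> S; rewrite addn2; apply: coloring_hypersphere.
Qed.
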